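(* Let $a\in\mathbb{Z}_{\geq0}$ and define the sequence $(b_j^a)_{j\ge0}$ recursively by $b_0^a:=-1$, $b_1^a:=-1$, and for $j\geq1$ $$b_{2j+1}^a:=-1-\sum_{l=0}^{j-1}b_{2l+1}^a\binom{a+2j+1}{a+2l+1}\frac{(2j-2l)!}{2^{j-l}(j-l)!},\qquad b_{2j}^a:=-1-\sum_{l=0}^{j-1}b_{2l}^a\binom{a+2j}{a+2l}\frac{(2j-2l)!}{2^{j-l}(j-l)!}.$$ Then $$-e^{-x^2/2}\left[\frac{e^x-\sum_{c=0}^{a-1}x^c/c!}{x^a}\right]=\sum_{j=0}^{\infty}\frac{b_j^a}{(a+j)!}x^j,\qquad x\in\mathbb{R},$$ where the quotient is extended continuously at $x=0$, with value $1/a!$, and the sum over $c$ is empty when $a=0$.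
   Context: No further notation is needed. *)

(* Defs.v *)
From Stdlib Require Import Reals Lra Lia Arith.
From Coquelicot Require Import Coquelicot.
Open Scope R_scope.

(* Sum of [f l] over 0 <= l < n; unlike [sum_f_R0 f (n - 1)], it is empty for n = 0. *)
Definition sum_lt (f : nat -> R) (n : nat) : R :=
  match n with O => 0 | S m => sum_f_R0 f m end.

(* [Binomial.C] is qualified because Coquelicot uses [C] for the complex numbers. *)
Record is_b_seq (a : nat) (b : nat -> R) : Prop := {
  b_seq_0 : b 0%nat = -1;
  b_seq_1 : b 1%nat = -1;
  b_seq_odd : forall j : nat, (1 <= j)%nat ->
    b (2 * j + 1)%nat =
      -1 - sum_lt (fun l => b (2 * l + 1)%nat
                      * Binomial.C (a + 2 * j + 1) (a + 2 * l + 1)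
                      * (INR (fact (2 * j - 2 * l))
                         / (2 ^ (j - l) * INR (fact (j - l))))) j;
  b_seq_even : forall j : nat, (1 <= j)%nat ->
    b (2 * j)%nat =
      -1 - sum_lt (fun l => b (2 * l)%nat
                      * Binomial.C (a + 2 * j) (a + 2 * l)
                      * (INR (fact (2 * j - 2 * l))
                         / (2 ^ (j - l) * INR (fact (j - l))))) j
}.

Definition exp_remainder_quotient (a : nat) (x : R) : R :=
  if Req_dec_T x 0 then / INR (fact a)
  else (exp x - sum_lt (fun c => x ^ c / INR (fact c)) a) / x ^ a.

(* The lemmas below show that quantifying over [b] with [is_b_seq a b] amounts to
   taking the one recursively defined sequence. *)

Lemma sum_lt_ext (f g : nat -> R) (n : nat) :
  (forall l, (l < n)%nat -> f l = g l) -> sum_lt f n = sum_lt g n.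
Proof.
destruct n as [|n]; simpl; intros H; [reflexivity|].
apply sum_eq; intros i Hi; apply H; lia.
Qed.

Lemma is_b_seq_unique (a : nat) (b b' : nat -> R) :
  is_b_seq a b -> is_b_seq a b' -> forall n, b n = b' n.
Proof.
intros [H0 H1 Ho He] [H0' H1' Ho' He'] n.
induction n as [n IH] using (well_founded_induction lt_wf).
destruct (Nat.Even_or_Odd n) as [[j ->]|[j ->]]; destruct j as [|j].
- simpl; congruence.
- rewrite He, He' by lia; f_equal; apply sum_lt_ext.
  intros l Hl; rewrite IH by lia; reflexivity.
- simpl; congruence.
- rewrite Ho, Ho' by lia; f_equal; apply sum_lt_ext.
  intros l Hl; rewrite IH by lia; reflexivity.
Qed.

Definition b_step (a : nat) (t : nat -> R) (n : nat) : R :=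
  let r := (n mod 2)%nat in let j := (n / 2)%nat in
  -1 - sum_lt (fun l => t (2 * l + r)%nat
                  * Binomial.C (a + 2 * j + r) (a + 2 * l + r)
                  * (INR (fact (2 * j - 2 * l))
                     / (2 ^ (j - l) * INR (fact (j - l))))) j.

Fixpoint b_table (a n : nat) : nat -> R :=
  match n with
  | O => fun _ => 0
  | S m => fun k => if (k =? m)%nat then b_step a (b_table a m) m else b_table a m k
  end.

Lemma b_table_stable (a n k : nat) :
  (k < n)%nat -> b_table a n k = b_table a (S k) k.
Proof.
induction n as [|n IH]; intros Hk; [lia|].
destruct (Nat.eq_dec k n) as [->|Hn]; [reflexivity|].
rewrite <- IH by lia; simpl.
destruct (Nat.eqb_spec k n); [lia|reflexivity].
Qed.

Lemma is_b_seq_exists (a : nat) : exists b : nat -> R, is_b_seq a b.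
Proof.
exists (fun k => b_table a (S k) k).
assert (E : forall n, b_table a (S n) n = b_step a (b_table a n) n).
{ intros n; simpl; now rewrite Nat.eqb_refl. }
split.
- rewrite E; unfold b_step; simpl; lra.
- rewrite E; unfold b_step; simpl; lra.
- intros j _; rewrite E; unfold b_step; cbv zeta.
  replace ((2 * j + 1) mod 2)%nat with 1%nat
    by (rewrite Nat.add_comm, Nat.mul_comm, Nat.Div0.mod_add; reflexivity).
  replace ((2 * j + 1) / 2)%nat with j
    by (rewrite Nat.add_comm, Nat.mul_comm, Nat.div_add; [reflexivity|lia]).
  f_equal; apply sum_lt_ext; intros l Hl.
  now rewrite b_table_stable by lia.
- intros j _; rewrite E; unfold b_step; cbv zeta.
  replace ((2 * j) mod 2)%nat with 0%nat
    by (rewrite Nat.mul_comm, Nat.Div0.mod_mul; reflexivity).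
  replace ((2 * j) / 2)%nat with j
    by (rewrite Nat.mul_comm, Nat.div_mul; [reflexivity|lia]).
  f_equal; apply sum_lt_ext; intros l Hl.
  rewrite !Nat.add_0_r.
  now rewrite b_table_stable by lia.
Qed.

(* Main.v *)
Require Import Defs.
From Stdlib Require Import Reals Arith Factorial Lra Lia.
From Coquelicot Require Import Coquelicot.
Open Scope R_scope.

(** Put [u n = b n / (a + n)!].  Dividing the recursion for [b n] by [(a + n)!]
    turns each binomial coefficient into a quotient of factorials and leaves
    a convolution: on each parity class, [r = 0] or [r = 1], the sequence
    [u (2 l + r)] convolved with the Taylor coefficients [(1/2)^k / k!] of
    [exp (y / 2)] equals [- 1 / (a + 2 l + r)!] ([b_seq_convolution]).

    Since [exp (y / 2)] has the entire inverse [exp (- y / 2)], such an equation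
    can be solved for [u]: its power series converges everywhere, to the
    right-hand side times [exp (- y / 2)] ([is_pseries_div_exp]).  Taking
    [y = x ^ 2] and adding the even part to [x] times the odd part, the factor
    [exp (- x ^ 2 / 2)] comes out, and the two halves of the right-hand side
    recombine into minus the series with coefficients [1 / (a + n)!].  That series
    is the exponential series with its first [a] terms removed and divided by
    [x ^ a], i.e. the exponential remainder quotient
    ([is_pseries_exp_remainder_quotient]). *)

(** * Entire power series *)

Lemma CV_radius_infinite (a : nat -> R) :
  (forall x, ex_pseries a x) -> CV_radius a = p_infty.
Proof.
intros H.
assert (Hle : forall r : R, Rbar_le r (CV_radius a)).
{ intros r; apply Rbar_not_lt_le; intros Hr.
  apply (CV_disk_outside a r).
  - apply Rbar_lt_le_trans with (1 := Hr); apply Rle_abs.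
  - apply ex_series_lim_0.
    destruct (H r) as [l Hl]; exists l; now apply is_pseries_R. }
destruct (CV_radius a) as [r | |]; auto.
- specialize (Hle (r + 1)); simpl in Hle; lra.
- now specialize (Hle 0).
Qed.

(** The Taylor coefficients at [0] of the function [exp (c * y)]. *)
Definition exp_coef (c : R) (n : nat) : R := c ^ n / INR (fact n).

Lemma exp_coef_0 (c : R) : exp_coef c 0 = 1.
Proof. unfold exp_coef; simpl; field. Qed.

Lemma is_pseries_exp_coef (c y : R) : is_pseries (exp_coef c) y (exp (c * y)).
Proof.
apply is_pseries_R.
apply is_series_ext with (2 := proj1 (is_pseries_R _ _ _) (is_exp_Reals (c * y))).
intros n; unfold exp_coef, Rdiv; rewrite Rpow_mult_distr.
rewrite <- Rmult_assoc, (Rmult_comm (/ _)); reflexivity.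
Qed.

Lemma CV_radius_exp_dominated (c : R) (a : nat -> R) :
  (forall n, Rabs (a n) <= exp_coef c n) -> CV_radius a = p_infty.
Proof.
intros H; apply CV_radius_infinite; intros x.
assert (Hex : ex_series (fun n => a n * x ^ n)).
{ apply (ex_series_le (K := R_AbsRing) (V := R_CompleteNormedModule)
           _ (fun n => exp_coef c n * Rabs x ^ n)).
  - intros n; change (Rabs (a n * x ^ n) <= exp_coef c n * Rabs x ^ n).
    rewrite Rabs_mult, RPow_abs.
    apply Rmult_le_compat_r; [apply Rabs_pos | apply H].
  - exists (exp (c * Rabs x)); apply is_pseries_R, is_pseries_exp_coef. }
destruct Hex as [l Hl]; exists l; now apply is_pseries_R.
Qed.

Lemma CV_radius_exp_coef (c : R) : CV_radius (exp_coef c) = p_infty.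
Proof.
apply CV_radius_exp_dominated with (Rabs c); intros n; unfold exp_coef.
rewrite Rabs_div by apply INR_fact_neq_0.
rewrite <- RPow_abs, (Rabs_pos_eq (INR _)) by apply pos_INR; lra.
Qed.

Lemma CV_radius_mult_infinite (a b : nat -> R) :
  CV_radius a = p_infty -> CV_radius b = p_infty ->
  CV_radius (PS_mult a b) = p_infty.
Proof.
intros Ha Hb; apply CV_radius_infinite; intros x.
apply ex_pseries_mult; [rewrite Ha | rewrite Hb]; exact I.
Qed.

(** * Division by the exponential series *)

(** The [n]-th coefficient of a product with [h] involves [u n] only through
    [u n * h 0], so the coefficients of [u] can be recovered one after another. *)
Lemma PS_mult_cancel_r (h u v : nat -> R) :
  h 0%nat <> 0 -> (forall n, PS_mult u h n = PS_mult v h n) ->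
  forall n, u n = v n.
Proof.
intros Hh H n.
induction n as [n IH] using (well_founded_induction lt_wf).
apply Rmult_eq_reg_r with (2 := Hh).
specialize (H n); unfold PS_mult in H.
destruct n as [|n]; [exact H|].
rewrite !tech5, Nat.sub_diag in H.
rewrite (sum_eq _ (fun k => v k * h (S n - k)%nat)) in H.
- lra.
- intros i Hi; now rewrite IH by lia.
Qed.

(** The series [u] is only known formally, so its convergence is obtained by
    identifying it with an entire one.  The product of [w] with the series of
    [exp (- c y)] is entire; multiplied by [exp (c y)] it gives back [w] as
    a function, hence coefficientwise, power series expansions being unique.
    By cancellation its coefficients are those of [u]. *)
Lemma is_pseries_div_exp (c : R) (u w : nat -> R) (y l : R) :
  CV_radius w = p_infty ->
  (forall n, PS_mult u (exp_coef c) n = w n) ->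
  is_pseries w y l -> is_pseries u y (l * exp (- c * y)).
Proof.
intros Hw Hu Hl.
assert (Hv : CV_radius (PS_mult w (exp_coef (- c))) = p_infty).
{ apply CV_radius_mult_infinite; [exact Hw | apply CV_radius_exp_coef]. }
apply is_pseries_ext with (PS_mult w (exp_coef (- c))).
- apply PS_mult_cancel_r with (exp_coef c).
  { rewrite exp_coef_0; exact R1_neq_R0. }
  intros n; rewrite Hu.
  apply PSeries_ext_recip.
  + rewrite CV_radius_mult_infinite; [exact I | exact Hv | apply CV_radius_exp_coef].
  + rewrite Hw; exact I.
  + apply filter_forall; intros x.
    rewrite !PSeries_mult;
      try (rewrite ?Hv, ?Hw, ?CV_radius_exp_coef; exact I).
    rewrite !(is_pseries_unique _ _ _ (is_pseries_exp_coef _ _)).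
    rewrite Rmult_assoc, <- exp_plus.
    replace (- c * x + c * x) with 0 by ring.
    rewrite exp_0; ring.
- apply is_pseries_mult; trivial.
  + apply is_pseries_exp_coef.
  + rewrite Hw; exact I.
  + rewrite CV_radius_exp_coef; exact I.
Qed.

(** * The recursion as a convolution *)

(** One term of the recursion, divided by [(a + n)!] with [n = m + 2 k]: the
    binomial coefficient cancels the factor [(2 k)!]. *)
Lemma recursion_term (a m n k : nat) (t : R) :
  n = (m + 2 * k)%nat ->
  t * Binomial.C (a + n) (a + m)
    * (INR (fact (2 * k)) / (2 ^ k * INR (fact k))) / INR (fact (a + n))
  = t / INR (fact (a + m)) * exp_coef (/ 2) k.
Proof.
intros ->; unfold Binomial.C, exp_coef.
replace (a + (m + 2 * k) - (a + m))%nat with (2 * k)%nat by lia.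
rewrite pow_inv; field.
repeat split; try apply INR_fact_neq_0; apply pow_nonzero; lra.
Qed.

Lemma b_seq_convolution (a : nat) (b : nat -> R) (r n : nat) :
  is_b_seq a b -> (r <= 1)%nat ->
  PS_mult (fun l => b (2 * l + r)%nat / INR (fact (a + (2 * l + r))))
    (exp_coef (/ 2)) n
  = - / INR (fact (a + (2 * n + r))).
Proof.
intros [H0 H1 Ho He] Hr.
assert (Hrec : b (2 * n + r)%nat =
  -1 - sum_lt (fun l => b (2 * l + r)%nat
                  * Binomial.C (a + (2 * n + r)) (a + (2 * l + r))
                  * (INR (fact (2 * (n - l)))
                     / (2 ^ (n - l) * INR (fact (n - l))))) n).
{ destruct n as [|n].
  - destruct r as [|[|r]]; simpl; try lia; lra.
  - destruct r as [|[|r]]; [rewrite Nat.add_0_r, He by lia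
                           | rewrite Ho by lia | lia];
    f_equal; apply sum_lt_ext; intros l Hl;
    now rewrite ?Nat.add_0_r, ?Nat.add_assoc, Nat.mul_sub_distr_l. }
pose proof (INR_fact_neq_0 (a + (2 * n + r))) as Hf.
unfold PS_mult; destruct n as [|n].
- simpl in Hrec |- *; rewrite Hrec, exp_coef_0; field; exact Hf.
- rewrite tech5, Nat.sub_diag, Hrec, exp_coef_0; unfold sum_lt.
  rewrite (sum_eq _ (fun l => b (2 * l + r)%nat
             * Binomial.C (a + (2 * S n + r)) (a + (2 * l + r))
             * (INR (fact (2 * (S n - l)))
                / (2 ^ (S n - l) * INR (fact (S n - l))))
             * / INR (fact (a + (2 * S n + r))))).
  + rewrite <- scal_sum; field; exact Hf.
  + intros l Hl; symmetry; apply recursion_term; lia.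
Qed.

(** * The shifted exponential series *)

Lemma CV_radius_inv_fact (f : nat -> nat) :
  (forall n, (n <= f n)%nat) ->
  CV_radius (fun n => - / INR (fact (f n))) = p_infty.
Proof.
intros Hf; apply CV_radius_exp_dominated with 1; intros n; unfold exp_coef.
rewrite pow1, Rabs_Ropp, Rabs_pos_eq.
- unfold Rdiv; rewrite Rmult_1_l; apply Rinv_le_contravar.
  + apply INR_fact_lt_0.
  + apply le_INR, fact_le, Hf.
- apply Rlt_le, Rinv_0_lt_compat, INR_fact_lt_0.
Qed.

Lemma is_pseries_exp_remainder_quotient (a : nat) (x : R) :
  is_pseries (fun n => / INR (fact (a + n))) x (exp_remainder_quotient a x).
Proof.
unfold exp_remainder_quotient; destruct (Req_dec_T x 0) as [-> | Hx].
- pose proof (is_pseries_0 (K := R_AbsRing) (V := R_NormedModule)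
                (fun n => / INR (fact (a + n)))) as H.
  simpl in H; rewrite Nat.add_0_r in H; exact H.
- apply is_pseries_R.
  pose proof (proj1 (is_pseries_R _ _ _) (is_exp_Reals x)) as He.
  assert (Htail : is_series (fun n => / INR (fact (a + n)) * x ^ (a + n))
            (exp x - sum_lt (fun c => x ^ c / INR (fact c)) a)).
  { destruct a as [|a].
    - simpl; rewrite Rminus_0_r; exact He.
    - apply (is_series_incr_n (fun n => / INR (fact n) * x ^ n) (S a)); [lia|].
      simpl pred; rewrite sum_n_Reals; simpl sum_lt.
      rewrite (sum_eq (fun n => / INR (fact n) * x ^ n)
                      (fun c => x ^ c / INR (fact c)))
        by (intros; apply Rmult_comm).
      unfold plus; simpl.
      rewrite Rminus_def, Rplus_assoc, Rplus_opp_l, Rplus_0_r; exact He. }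
  apply (is_series_scal_r (/ x ^ a)) in Htail.
  apply is_series_ext with (2 := Htail).
  intros n; change (/ INR (fact (a + n)) * x ^ (a + n) * / x ^ a
                    = / INR (fact (a + n)) * x ^ n).
  rewrite pow_add; field.
  split; [apply INR_fact_neq_0 | now apply pow_nonzero].
Qed.

(** * The generating function *)

Theorem theorem6p2 (a : nat) (b : nat -> R) (hb : is_b_seq a b) (x : R) :
  is_series (fun j : nat => b j / INR (fact (a + j)) * x ^ j)
    (- exp (- (x ^ 2 / 2)) * exp_remainder_quotient a x).
Proof.
set (u := fun j => b j / INR (fact (a + j))).
set (w := fun j => - / INR (fact (a + j))).
set (ev := PSeries (fun n => w (2 * n + 0)%nat) (x ^ 2)).
set (od := PSeries (fun n => w (2 * n + 1)%nat) (x ^ 2)).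
assert (Hrad : forall r, CV_radius (fun n => w (2 * n + r)%nat) = p_infty).
{ intros r; apply (CV_radius_inv_fact (fun n => a + (2 * n + r))%nat); lia. }
assert (Hw : forall r, is_pseries (fun n => w (2 * n + r)%nat) (x ^ 2)
               (PSeries (fun n => w (2 * n + r)%nat) (x ^ 2))).
{ intros r; apply PSeries_correct, CV_radius_inside; rewrite Hrad; exact I. }
assert (Hu : forall r, (r <= 1)%nat ->
  is_pseries (fun n => u (2 * n + r)%nat) (x ^ 2)
    (PSeries (fun n => w (2 * n + r)%nat) (x ^ 2) * exp (- / 2 * x ^ 2))).
{ intros r Hr; apply is_pseries_div_exp with (1 := Hrad r); [|apply Hw].
  intros n; now apply b_seq_convolution. }
assert (Hev : forall (s : nat -> R) l,
  is_pseries (fun n => s (2 * n + 0)%nat) (x ^ 2) l ->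
  is_pseries (fun n => s (2 * n)%nat) (x ^ 2) l).
{ intros s l; apply is_pseries_ext; intros n; now rewrite Nat.add_0_r. }
assert (Hsum : ev + x * od = - exp_remainder_quotient a x).
{ rewrite <- (is_pseries_unique w x (ev + x * od)).
  - apply is_pseries_unique.
    apply (is_pseries_opp _ x _ (is_pseries_exp_remainder_quotient a x)).
  - apply is_pseries_odd_even; [apply Hev|]; apply Hw. }
apply (is_pseries_R u).
replace (- exp (- (x ^ 2 / 2)) * exp_remainder_quotient a x)
  with (ev * exp (- / 2 * x ^ 2) + x * (od * exp (- / 2 * x ^ 2))).
- apply is_pseries_odd_even; [apply Hev|]; apply Hu; lia.
- replace (- (x ^ 2 / 2)) with (- / 2 * x ^ 2) by field.
  replace (exp_remainder_quotient a x) with (- (ev + x * od))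
    by (rewrite Hsum; ring).
  ring.
Qed.
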